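(* For all integers $n\ge 5$, $$\left\lfloor\frac n2\right\rfloor\le \mathrm{ID}_2(n)\le n-3.$$
   Context: Let $X$ be a finite set with $|X|\ge 3$. A split of $X$ is an unordered bipartition $A|B=B|A$ of $X$ into two non-empty disjoint subsets (its parts) with $A\cup B=X$. Its size is $\min\{|A|,|B|\}$; a split of size 1 is called trivial. A split system on $X$ is a set $\mathcal S$ of splits of $X$ that contains all trivial splits $\{x\}|X-\{x\}$, $x\in X$. For $S\in\mathcal S$ and $x\in X$, $S(x)$ denotes the part of $S$ containing $x$. The Buneman graph $\mathcal B(\mathcal S)$ has as vertices all maps $\phi:\mathcal S\to\mathcal P(X)$ such that (B1) $\phi(S)\in S$ for all $S\in\mathcal S$, and (B2) $\phi(S)\cap\phi(S')\ne\emptyset$ for all distinct $S,S'\in\mathcal S$. Two vertices $\phi,\phi'$ are adjacent if there is a unique $S\in\mathcal S$ with $\phi(S)\neq\phi'(S)$. For $x\in X$, $\phi_x$ denotes the vertex $S\mapsto S(x)$. It is known that $\mathcal B(\mathcal S)$ is a median graph, i.e. it is connected and any three vertices $u,v,w$ have a unique median (a vertex lying on shortest paths between each pair of $u,v,w$). For $Y=\{x,y,z\}\in\binom X3$, $\phi_Y$ denotes the median of $\phi_x,\phi_y,\phi_z$ in $\mathcal B(\mathcal S)$. The split system $\mathcal S$ is injective if $\phi_Y\ne\phi_{Y'}$ for all distinct $Y,Y'\in\binom X3$. Two distinct splits $A|B$ and $C|D$ of $X$ are incompatible if $A\cap C$, $A\cap D$, $B\cap C$, $B\cap D$ are all non-empty.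 A set of splits is incompatible if any two distinct splits in it are incompatible. The dimension $\dim(\mathcal S)$ is the dimension of the largest hypercube contained in $\mathcal B(\mathcal S)$ (and 1 if $\mathcal B(\mathcal S)$ is a tree); equivalently (known), it is the maximum size of an incompatible subset of $\mathcal S$. For $n\ge 3$, let $\mathbb S_2(n)$ be the set of all injective split systems on $\{1,\dots,n\}$ all of whose non-trivial splits have size 2, and let $\mathrm{ID}_2(n)=\min\{\dim(\mathcal S):\mathcal S\in\mathbb S_2(n)\}$. *)

(* Defs.v *)
From mathcomp Require Import all_boot.

Set Implicit Arguments.
Unset Strict Implicit.
Unset Printing Implicit Defensive.

Section Graph.

Variables (V : finType) (e : rel V).

Definition walk_of_length (u v : V) (k : nat) : bool :=
  [exists p : k.-tuple V, path e u p && (last u p == v)].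

(* Graph distance; equal to #|V| when u and v are not connected. *)
Definition gdist (u v : V) : nat :=
  find (walk_of_length u v) (iota 0 #|V|).

Definition on_shortest_path (u v m : V) : bool :=
  [exists p : (gdist u v).-tuple V,
     [&& path e u p, last u p == v & m \in u :: p]].

Definition is_median (u v w m : V) : bool :=
  [&& on_shortest_path u v m, on_shortest_path v w m & on_shortest_path u w m].

Definition contains_hypercube (k : nat) : bool :=
  [exists f : {ffun {ffun 'I_k -> bool} -> V},
     injectiveb f &&
     [forall a : {ffun 'I_k -> bool}, forall b : {ffun 'I_k -> bool},
        (#|[set i | a i != b i]| == 1) ==> e (f a) (f b)]].

(* The bound k < #|V| loses nothing, because k < 2 ^ k <= #|V| for every
   k-cube contained in the graph.  A tree with an edge has value 1, an edge
   being a 1-cube. *)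
Definition hypercube_dim : nat :=
  \max_(k < #|V| | contains_hypercube k) k.

End Graph.

Section Splits.

Variable T : finType.

Definition is_split (S : {set {set T}}) : bool :=
  [exists A : {set T}, [&& A != set0, ~: A != set0 & S == [set A; ~: A]]].

Definition split_size (S : {set {set T}}) : nat :=
  \big[minn/#|T|]_(A in S) #|A|.

Definition trivial_split (x : T) : {set {set T}} := [set [set x]; ~: [set x]].

Definition is_split_system (SS : {set {set {set T}}}) : bool :=
  [forall S in SS, is_split S] && [forall x : T, trivial_split x \in SS].

Definition split_system := {SS : {set {set {set T}}} | is_split_system SS}.

Definition split_in (SS : split_system) :=
  {S : {set {set T}} | S \in val SS}.

Section Buneman.

Variable SS : split_system.

Definition is_buneman_vertex (phi : {ffun split_in SS -> {set T}}) : bool :=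
  [forall S, phi S \in val S] &&
  [forall S, forall S', (S != S') ==> (phi S :&: phi S' != set0)].

Definition buneman := {phi : {ffun split_in SS -> {set T}} | is_buneman_vertex phi}.

Definition buneman_adj : rel buneman :=
  fun phi phi' => #|[set S | val phi S != val phi' S]| == 1.

(* pblock S x is the part of S containing x. *)
Definition point_map (x : T) : {ffun split_in SS -> {set T}} :=
  [ffun S => pblock (val S) x].

Lemma mem_cover_split (S : split_in SS) (x : T) : x \in cover (val S).
Proof.
have /andP[/forall_inP/(_ _ (valP S)) /existsP[A /and3P[_ _ /eqP ->]] _] :=
  valP SS.
apply/bigcupP; case: (boolP (x \in A)) => xA.
  by exists A; rewrite ?inE ?eqxx.
by exists (~: A); rewrite ?inE ?eqxx ?orbT.
Qed.

Lemma point_map_vertex (x : T) : is_buneman_vertex (point_map x).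
Proof.
apply/andP; split.
  by apply/forallP => S; rewrite ffunE pblock_mem ?mem_cover_split.
apply/forallP => S; apply/forallP => S'; apply/implyP => _.
by apply/set0Pn; exists x; rewrite !ffunE inE !mem_pblock !mem_cover_split.
Qed.

Definition point_vertex (x : T) : buneman := Sub (point_map x) (point_map_vertex x).

(* phi_Y for a 3-subset Y.  The option accounts only for the existence of the
   median, which holds in every Buneman graph, where it is also unique. *)
Definition triple_median (Y : {set T}) : option buneman :=
  [pick m | [exists x, exists y, exists z,
     (Y == [set x; y; z]) &&
     is_median buneman_adj (point_vertex x) (point_vertex y) (point_vertex z) m]].

Definition injective_system : bool :=
  [forall Y : {set T}, forall Y' : {set T},
     [&& #|Y| == 3, #|Y'| == 3 & Y != Y'] ==>
     (triple_median Y != triple_median Y')].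

Definition system_dim : nat := hypercube_dim buneman_adj.

End Buneman.

End Splits.

Definition S2 (n : nat) : {set split_system 'I_n} :=
  [set SS | injective_system SS &
     [forall S in val SS, (split_size S != 1) ==> (split_size S == 2)]].

(* Minimum of system_dim over S2 n; the value 0 is used only if S2 n is empty. *)
Definition ID2 (n : nat) : nat :=
  if [pick SS in S2 n] is Some SS0
  then system_dim [arg min_(SS < SS0 in S2 n) system_dim SS]
  else 0.

(* Main.v *)
(** Let G be the graph on [X] whose edges are the size-2 splits [{a,b}|rest].
    Shortest paths in the Buneman graph flip each differing split once, so the
    median of three vertices is taken splitwise by majority, and injectivity says
    that a triple is determined by the edges of G it contains.  For an edge [ab]
    this leaves at most one vertex adjacent to neither [a] nor [b], so that one of
    them has degree at least [(n - 1) / 2]; the splits through a vertex are pairwise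
    incompatible and span a cube.  Conversely a cube of dimension at least 2
    yields pairwise intersecting edges, that is, a star or a triangle, and for the
    complement of an n-cycle these have at most [n - 3] edges. *)

From HB Require Import structures.
Require Import Defs.
From mathcomp Require Import all_boot.
From mathcomp Require Import zify.

Set Implicit Arguments.
Unset Strict Implicit.
Unset Printing Implicit Defensive.

(** * Walks and distance in a finite graph *)

Section GraphDistance.

Variables (V : finType) (e : rel V).

Lemma walk_of_lengthP (u v : V) (k : nat) :
  reflect (exists p, [/\ path e u p, last u p = v & size p = k])
          (walk_of_length e u v k).
Proof.
apply: (iffP existsP) => [[p /andP[up /eqP lp]]|[p [up lp sp]]].
  by exists p; rewrite size_tuple.
have sp' : size p == k by rewrite sp.
by exists (Tuple sp'); rewrite /= up lp eqxx.
Qed.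

Lemma on_shortest_pathP (u v m : V) :
  reflect (exists p, [/\ path e u p, last u p = v, size p = gdist e u v
                       & m \in u :: p])
          (on_shortest_path e u v m).
Proof.
apply: (iffP existsP) => [[p /and3P[up /eqP lp mp]]|[p [up lp sp mp]]].
  by exists p; rewrite size_tuple.
have sp' : size p == gdist e u v by rewrite sp.
by exists (Tuple sp'); rewrite /= up lp eqxx.
Qed.

(** Removing repeated vertices from a walk of length [d] leaves a walk with fewer than [#|V|] steps,
    so [d < #|V|] and the search in [gdist] stops at [d] before running out. *)
Lemma gdist_eq (u v : V) (d : nat) :
  (forall p, path e u p -> last u p = v -> d <= size p) ->
  (exists p, [/\ path e u p, last u p = v & size p = d]) ->
  gdist e u v = d.
Proof.
move=> dmin [p [up lp sp]].
have d_lt : d < #|V|.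
  move: up lp sp; case/shortenP => q uq uniq_q _ lq _.
  have := dmin _ uq lq; move/leq_ltn_trans; apply.
  by have := max_card (mem (u :: q)); rewrite (card_uniqP uniq_q).
have wd : walk_of_length e u v (nth 0 (iota 0 #|V|) d).
  by rewrite nth_iota // add0n; apply/walk_of_lengthP; exists p.
have has_d : has (walk_of_length e u v) (iota 0 #|V|).
  apply/hasP; exists (nth 0 (iota 0 #|V|) d) => //.
  by rewrite mem_nth // size_iota.
have find_lt : gdist e u v < #|V|.
  by have := has_d; rewrite has_find size_iota.
apply/eqP; rewrite eqn_leq; apply/andP; split.
  by rewrite leqNgt; apply/negP => /(before_find (s := iota 0 #|V|) 0); rewrite wd.
have := nth_find 0 has_d; rewrite -/(gdist e u v) nth_iota // add0n.
by case/walk_of_lengthP => q [uq lq <-]; apply: dmin.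
Qed.

End GraphDistance.

(** * Distances and medians in the Buneman graph, split by split *)

Section Buneman.

Variables (T : finType) (SS : split_system T).
Implicit Types (S : split_in SS) (u v w m : buneman SS).

Lemma split_inP S : exists A : {set T}, val S = [set A; ~: A].
Proof.
have /andP[/forall_inP/(_ _ (valP S)) /existsP[A /and3P[_ _ /eqP ->]] _] :=
  valP SS.
by exists A.
Qed.

Lemma split_parts S (A : {set T}) : A \in val S -> val S = [set A; ~: A].
Proof.
have [B ->] := split_inP S.
by rewrite !inE => /orP[] /eqP-> //; rewrite setCK setUC.
Qed.

Lemma split_in_eq S S' (A : {set T}) : A \in val S -> A \in val S' -> S = S'.
Proof. by move=> /split_parts AS /split_parts AS'; apply: val_inj; rewrite /= AS AS'. Qed.

Lemma part_neq S (A B : {set T}) : A \in val S -> B \in val S -> A != B -> B = ~: A.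
Proof.
by move=> /split_parts ->; rewrite !inE eq_sym => /orP[] /eqP-> //; rewrite eqxx.
Qed.

Lemma part_neq2 S (A B C : {set T}) :
  A \in val S -> B \in val S -> C \in val S -> A != B -> B != C -> A = C.
Proof.
move=> AS BS CS /(part_neq AS BS) AB /(part_neq BS CS) ->.
by rewrite AB setCK.
Qed.

Lemma buneman_mem u S : val u S \in val S.
Proof. by have /andP[/forallP] := valP u. Qed.

Lemma buneman_meet u S S' : S != S' -> val u S :&: val u S' != set0.
Proof.
by have /andP[_ /forallP/(_ S)/forallP/(_ S')/implyP] := valP u.
Qed.

Definition hamming u v : nat := #|[set S | val u S != val v S]|.

Lemma hammingE u v : hamming u v = \sum_S (val u S != val v S).
Proof.
by rewrite /hamming -sum1_card big_mkcond; apply: eq_bigr => S _; rewrite inE; case: eqP.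
Qed.

Lemma leq_hamming u v w : hamming u w <= hamming u v + hamming v w.
Proof.
rewrite !hammingE -big_split; apply: leq_sum => S _ /=.
by case: (eqVneq (val u S) (val v S)) => [->|_] //; case: (_ != val w S).
Qed.

Lemma hamming_path u p : path (@buneman_adj _ SS) u p -> hamming u (last u p) <= size p.
Proof.
elim: p u => [u _|v p IH u /= /andP[/eqP uv vp]].
  by rewrite leqn0 hammingE big1 // => S _; rewrite eqxx.
by rewrite (leq_trans (leq_hamming u v _)) // [hamming u v]uv add1n ltnS IH.
Qed.

(* Reorienting [S] is possible when [val u S] is inclusion-minimal among the
   parts on which [u] and [v] differ. *)
Lemma hamming_step u v : u != v ->
  exists2 w, buneman_adj u w & hamming u v = (hamming w v).+1.
Proof.
move=> uv.
have [S0 S0uv] : exists S, val u S != val v S.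
  apply/existsP; apply: contraNT uv; rewrite negb_exists => /forallP uv.
  apply/eqP/val_inj/ffunP => S; exact/eqP/negPn/uv.
have [S SD Smin] := arg_minnP (P := fun S => val u S != val v S)
  (fun S => #|val u S|) S0uv.
pose f : {ffun split_in SS -> {set T}} :=
  [ffun S' => if S' == S then val v S else val u S'].
have fv : is_buneman_vertex f.
  have vE : val v S = ~: val u S by apply: part_neq SD; apply: buneman_mem.
  (* If [val v S] missed [val u S'], then [val u S'] would lie inside [val u S]. Condition (B2) for
     [v] excludes agreement of [u] and [v] on [S'], and minimality excludes disagreement. *)
  have meetS S' : S' != S -> val v S :&: val u S' != set0.
    move=> S'S; apply/eqP => disj.
    have sub : val u S' \subset val u S.
      by rewrite -[val u S]setCK -vE -disjoints_subset -setI_eq0 setIC disj.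
    have [uv'|/eqP S'D] := eqVneq (val u S') (val v S').
      by move: (buneman_meet v S'S); rewrite -uv' setIC disj eqxx.
    have /eqP E : val u S' == val u S by rewrite eqEcard sub Smin //; apply/eqP.
    have mS := buneman_mem u S; rewrite -E in mS.
    by move/eqP: S'S; apply; apply: split_in_eq mS; apply: buneman_mem.
  apply/andP; split; apply/forallP => S1.
    by rewrite ffunE; case: eqP => [->|_]; apply: buneman_mem.
  apply/forallP => S2; apply/implyP => S12; rewrite !ffunE.
  have [E1|S1S] := eqVneq S1 S; have [E2|S2S] := eqVneq S2 S.
  - by rewrite E1 E2 eqxx in S12.
  - exact: meetS.
  - by rewrite setIC meetS.
  - exact: buneman_meet.
pose w : buneman SS := Sub f fv.
exists w.
  apply/cards1P; exists S; apply/setP => S'; rewrite !inE ffunE.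
  by case: (eqVneq S' S) => [->|_]; [exact: SD|rewrite eqxx].
rewrite !hammingE (bigD1 S) //= SD [X in _ = X.+1](bigD1 S) //= ffunE eqxx eqxx add0n.
by rewrite add1n; congr _.+1; apply: eq_bigr => S' /negPf S'S; rewrite ffunE S'S.
Qed.

Lemma hamming_walk u v :
  exists p, [/\ path (@buneman_adj _ SS) u p, last u p = v & size p = hamming u v].
Proof.
have [k] := ubnP (hamming u v); elim: k u => // k IH u.
have [-> _|uv] := eqVneq u v.
  by exists [::]; split=> //; rewrite hammingE big1 // => S _; rewrite eqxx.
have [w uw ->] := hamming_step uv; rewrite ltnS => /IH[p [wp lp sp]].
by exists (w :: p); rewrite /= uw wp sp.
Qed.

Lemma buneman_gdist u v : gdist (@buneman_adj _ SS) u v = hamming u v.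
Proof.
apply: gdist_eq; last exact: hamming_walk.
by move=> p up <-; apply: hamming_path.
Qed.

(** A shortest path through [m] breaks into two walks, each at least as long as the Hamming distance
    of its ends; conversely, shortest walks to and from [m] concatenate. *)
Lemma on_shortest_path_hamming u v m :
  on_shortest_path (@buneman_adj _ SS) u v m =
  (hamming u m + hamming m v == hamming u v).
Proof.
apply/on_shortest_pathP/eqP => [[p [up lp sp mp]]|E].
  rewrite buneman_gdist in sp.
  apply/eqP; rewrite eqn_leq leq_hamming andbT -sp.
  case/splitPl: mp up lp sp => p1 p2 lp1.
  rewrite cat_path last_cat lp1 size_cat => /andP[up1 mp2] lp2 _.
  by rewrite leq_add // -?lp2 -?[in leqLHS]lp1 hamming_path // lp1.
have [p [up lp sp]] := hamming_walk u m; have [q [uq lq sq]] := hamming_walk m v.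
exists (p ++ q); rewrite cat_path last_cat lp up uq lq size_cat sp sq E.
split=> //; first by rewrite buneman_gdist.
by rewrite -cat_cons mem_cat -lp mem_last.
Qed.

(** The triangle inequality for [hamming] holds in each summand, so equality of the sums means
    equality at every split. *)
Lemma on_shortest_pathE u v m :
  on_shortest_path (@buneman_adj _ SS) u v m =
  [forall S, (val u S == val v S) ==> (val m S == val u S)].
Proof.
rewrite on_shortest_path_hamming eq_sym.
have H S : true ->
    (val u S != val v S) <= (val u S != val m S) + (val m S != val v S) ?= iff
    ((val u S == val v S) ==> (val m S == val u S)).
  move=> _.
  have [uv|uv] /= := eqVneq (val u S) (val v S).
    rewrite -uv [val u S == _]eq_sym; split=> //.
    by case: (val m S == _).
  have [um|um] := eqVneq (val u S) (val m S); first by rewrite -um uv.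
  have [//|mv] := eqVneq (val m S) (val v S).
  have E := part_neq2 (buneman_mem u S) (buneman_mem m S) (buneman_mem v S) um mv.
  by rewrite E eqxx in uv.
have /leqifP := leqif_sum H; rewrite big_split -!hammingE /=.
by case: ifP => [_ /eqP->|_ /ltn_eqF]; rewrite ?eqxx.
Qed.

Definition majority u v w S (A : {set T}) : bool :=
  [|| (val u S == A) && (val v S == A), (val v S == A) && (val w S == A)
    | (val u S == A) && (val w S == A)].

Lemma is_medianE u v w m :
  is_median (@buneman_adj _ SS) u v w m = [forall S, majority u v w S (val m S)].
Proof.
rewrite /is_median !on_shortest_pathE.
apply/and3P/forallP => [[/forallP uv /forallP vw /forallP uw] S|maj].
  have {uv vw uw} [uv vw uw] := And3 (uv S) (vw S) (uw S); rewrite /majority.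
  have [E|n_uv] := eqVneq (val u S) (val v S).
    by move: uv; rewrite -E eqxx implyTb => /eqP->; rewrite !eqxx.
  have [E|n_vw] := eqVneq (val v S) (val w S).
    by move: vw; rewrite -E eqxx implyTb => /eqP->; rewrite !eqxx orbT.
  have E := part_neq2 (buneman_mem u S) (buneman_mem v S) (buneman_mem w S) n_uv n_vw.
  by move: uw; rewrite -E eqxx implyTb => /eqP->; rewrite !eqxx !orbT.
split; apply/forallP => S; apply/implyP => /eqP E; move: (maj S);
  by rewrite /majority E [val m S == _]eq_sym; case/or3P => /andP[].
Qed.

(** Any two majorities among three voters share a voter. Parts chosen by majority thus inherit (B2)
    from that voter. *)
Lemma majority_common u v w S S' (A B : {set T}) :
  majority u v w S A -> majority u v w S' B ->
  exists t : buneman SS, val t S = A /\ val t S' = B.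
Proof.
by case/or3P=> /andP[/eqP A1 /eqP A2]; case/or3P=> /andP[/eqP B1 /eqP B2];
  first [by exists u | by exists v | by exists w].
Qed.

(** A split has only two parts, so when [u] and [v] disagree, [w] casts the deciding vote. *)
Definition median_map u v w : {ffun split_in SS -> {set T}} :=
  [ffun S => if val u S == val v S then val u S else val w S].

Lemma median_map_majority u v w S : majority u v w S (median_map u v w S).
Proof.
rewrite /majority ffunE; case: ifP => [/eqP E|/negbT uv]; first by rewrite E !eqxx.
have [E|vw] := eqVneq (val v S) (val w S); first by rewrite !eqxx orbT.
have E := part_neq2 (buneman_mem u S) (buneman_mem v S) (buneman_mem w S) uv vw.
by rewrite E !eqxx !orbT.
Qed.

Lemma median_map_vertex u v w : is_buneman_vertex (median_map u v w).
Proof.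
apply/andP; split; apply/forallP => S1.
  by rewrite ffunE; case: ifP => _; apply: buneman_mem.
apply/forallP => S2; apply/implyP => S12.
have [t [<- <-]] :=
  majority_common (median_map_majority u v w S1) (median_map_majority u v w S2).
exact: buneman_meet.
Qed.

Lemma part_partition S : trivIset (val S).
Proof.
apply/trivIsetP => A B AS BS AB.
by rewrite (part_neq AS BS AB) disjoints_subset setCK.
Qed.

Lemma point_vertexE S (A : {set T}) x :
  A \in val S -> (val (point_vertex SS x) S == A) = (x \in A).
Proof.
move=> AS; rewrite /= ffunE; apply/eqP/idP => [<-|xA].
  by rewrite mem_pblock mem_cover_split.
exact: (def_pblock (part_partition S) AS xA).
Qed.

(** At each split a median takes the part holding at least two points of [Y], in whatever order the
    points are listed. The majority map shows that the search for a median succeeds. *)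
Lemma triple_median_majority (Y : {set T}) : #|Y| = 3 ->
  exists2 m, triple_median SS Y = Some m & forall S, 2 <= #|val m S :&: Y|.
Proof.
move=> Y3.
have majE x y z m : Y = [set x; y; z] ->
    is_median (@buneman_adj _ SS) (point_vertex SS x) (point_vertex SS y)
      (point_vertex SS z) m = [forall S, 2 <= #|val m S :&: Y|].
  move=> YE; rewrite is_medianE; apply: eq_forallb => S.
  rewrite /majority !point_vertexE ?buneman_mem //.
  have -> : #|val m S :&: Y| = (x \in val m S) + (y \in val m S) + (z \in val m S).
    have uY : uniq [:: x; y; z].
      (* The three points are distinct because [Y] has three elements. *)
      by apply/card_uniqP; rewrite [RHS]/= -Y3 YE; apply: eq_card => t; rewrite !inE orbA.
    transitivity (count [in val m S] [:: x; y; z]).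
      rewrite -size_filter -(card_uniqP (filter_uniq _ uY)).
      by apply: eq_card => t; rewrite YE mem_filter !inE orbA.
    by rewrite /= addn0 addnA.
  by do 3!case: (_ \in _).
rewrite /triple_median; case: pickP => [m /existsP[x /existsP[y /existsP[z]]]|none].
  by case/andP => /eqP /majE -> /forallP Ym; exists m.
have [x [y [z YE]]] : exists x y z, Y = [set x; y; z].
  move: Y3; have [[|x [|y [|z []]]]//= _ _] := cards_eqP.
  by exists x, y, z; apply/setP => t; rewrite !inE orbA.
pose m : buneman SS := Sub _ (median_map_vertex (point_vertex SS x)
  (point_vertex SS y) (point_vertex SS z)).
have /negbT/negP[] := none m; apply/existsP; exists x; apply/existsP; exists y.
apply/existsP; exists z; rewrite YE eqxx is_medianE andTb.
by apply/forallP => S; apply: median_map_majority.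
Qed.

(** Three points are distributed over two parts, so exactly one part receives at least two of
    them. *)
Lemma two_in_part (Y A B : {set T}) S : #|Y| = 3 -> A \in val S -> B \in val S ->
  2 <= #|B :&: Y| -> (2 <= #|A :&: Y|) = (A == B).
Proof.
move=> Y3 AS BS B2; have [-> //|AB] := eqVneq A B.
have := cardsID B Y; rewrite Y3 (part_neq BS AS) 1?eq_sym //.
rewrite setIC setDE [Y :&: _]setIC; lia.
Qed.

(** Medians disappear here: a triple matters only through the parts that hold at least two of its
    points. *)
Lemma injective_systemP :
  reflect (forall Y Y' : {set T}, #|Y| = 3 -> #|Y'| = 3 ->
             (forall S A, A \in val S -> (2 <= #|A :&: Y|) = (2 <= #|A :&: Y'|)) ->
             Y = Y')
          (injective_system SS).
Proof.
apply: (iffP forallP) => [inj Y Y' Y3 Y3' same|inj Y].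
  apply/eqP; apply: contraT => YY'.
  have /forallP/(_ Y')/implyP := inj Y; rewrite Y3 Y3' eqxx YY' => /(_ isT).
  have [m -> mY] := triple_median_majority Y3.
  have [m' -> mY'] := triple_median_majority Y3'.
  case/eqP; congr Some; apply/val_inj/ffunP => S.
  apply/eqP; rewrite -(two_in_part Y3' (buneman_mem m S) (buneman_mem m' S) (mY' S)).
  by rewrite -(same S) ?buneman_mem.
apply/forallP => Y'; apply/implyP => /and3P[/eqP Y3 /eqP Y3' /eqP YY'].
apply/negP => /eqP; have [m -> mY] := triple_median_majority Y3.
have [m' -> mY'] := triple_median_majority Y3'.
case=> E; apply: YY'; apply: inj => // S A AS; rewrite -E in mY'.
have mS := buneman_mem m S.
by rewrite (two_in_part Y3 AS mS (mY S)) (two_in_part Y3' AS mS (mY' S)).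
Qed.

End Buneman.

(** * Size-2 splits as edges of a graph, and cubes built from them *)

HB.instance Definition _ := SemiGroup.isComLaw.Build nat minn minnA minnC.

(** After both parts are peeled off, the initial value [#|T|] remains and is absorbed, as it bounds
    every part. Since [minn] on [nat] has no neutral element, the law declared above is only a
    semigroup law. *)
Lemma split_sizeE (T : finType) (A : {set T}) :
  split_size [set A; ~: A] = minn #|A| #|~: A|.
Proof.
rewrite /split_size (bigD1 A) ?set21 //.
(* [A] equals its complement only when [T] is empty; the split then has a single part. *)
have [E|ne] := eqVneq A (~: A).
  rewrite big_pred0 => [|B]; last by rewrite -E !inE orbb andbN.
  by rewrite -E minnn; apply/minn_idPl/max_card.
rewrite (bigD1 (~: A)) ?set22 1?eq_sym //.
rewrite big_pred0 => [|B]; last by rewrite !inE; do 2!case: eqP.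
by congr minn; apply/minn_idPl/max_card.
Qed.

Section Pairs.

Variables (T : finType) (SS : split_system T).

(** The edges of [G]. From five points on, the other part of such a split has at least three points,
    so a split gives at most one edge. *)
Definition pairs : {set {set T}} :=
  [set A : {set T} | (#|A| == 2) && ([set A; ~: A] \in val SS)].

Definition sizes_le2 : bool :=
  [forall S in val SS, (split_size S != 1) ==> (split_size S == 2)].

Lemma pairs_card A : A \in pairs -> #|A| = 2.
Proof. by rewrite inE => /andP[/eqP]. Qed.

Lemma pairs_split A : A \in pairs -> exists S : split_in SS, val S = [set A; ~: A].
Proof. by rewrite inE => /andP[_ AS]; exists (Sub [set A; ~: A] AS). Qed.

Lemma small_part (S : split_in SS) : sizes_le2 ->
  exists A : {set T}, val S = [set A; ~: A] /\ (#|A| = 1 \/ A \in pairs).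
Proof.
move=> /forall_inP/(_ _ (valP S)) size_S.
have [A SE] : exists A : {set T}, val S = [set A; ~: A] /\ #|A| <= #|~: A|.
  have [A SE] := split_inP S; have [le|/ltnW le] := leqP #|A| #|~: A|.
    by exists A.
  by exists (~: A); rewrite setCK setUC.
have SSA : [set A; ~: A] \in val SS by rewrite -(proj1 SE); exact: (valP S).
exists A; split; first by case: SE.
rewrite inE SSA andbT; move: size_S; case: SE => /= -> le.
rewrite split_sizeE (minn_idPl le); case: eqP => [->|_ /= /eqP ->]; first by left.
by right.
Qed.

Lemma card_setI_ge2 (A Y : {set T}) : #|A| = 2 -> (2 <= #|A :&: Y|) = (A \subset Y).
Proof.
move=> A2; rewrite -[X in X <= _]A2.
by rewrite (sameP setIidPl eqP) eqEcard subsetIl.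
Qed.

(** A singleton never holds two points of a triple, a pair does so exactly when contained in it, and
    the answer for a complement is the opposite one. Hence only edges tell triples apart. *)
Lemma injective_pairsP : sizes_le2 ->
  reflect (forall Y Y' : {set T}, #|Y| = 3 -> #|Y'| = 3 ->
             (forall A, A \in pairs -> (A \subset Y) = (A \subset Y')) -> Y = Y')
          (injective_system SS).
Proof.
move=> sz; apply: (iffP (injective_systemP SS)) => inj Y Y' Y3 Y3' same;
  apply: inj => //.
  move=> S A AS; have [B [SE B12]] := small_part S sz.
  have sameB : (2 <= #|B :&: Y|) = (2 <= #|B :&: Y'|).
    case: B12 => [B1|BP]; last by rewrite !card_setI_ge2 ?(pairs_card BP) ?same.
    by rewrite !ltnNge -B1 !subset_leq_card ?subsetIl.
  move: AS; rewrite SE !inE => /orP[] /eqP-> //.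
  have cY (Z : {set T}) : #|Z| = 3 -> (2 <= #|~: B :&: Z|) = ~~ (2 <= #|B :&: Z|).
    by move=> Z3; have := cardsID B Z; rewrite Z3 setDE setIC [Z :&: _]setIC; lia.
  by rewrite !cY ?sameB.
move=> A AP; have [S SE] := pairs_split AP.
rewrite -!card_setI_ge2 ?(pairs_card AP) //.
by apply: (same S); rewrite SE set21.
Qed.

Hypotheses (sz : sizes_le2) (T5 : 5 <= #|T|).

(* A split with a part in [F] points to that part, every other split to its
   larger part. *)
Definition oriented (F : {set {set T}}) (A : {set T}) : bool :=
  (A \in F) || (2 < #|A|) && (~: A \notin F).

Definition cube_map (F : {set {set T}}) : {ffun split_in SS -> {set T}} :=
  [ffun S : split_in SS => odflt set0 [pick A in val S | oriented F A]].

Lemma cube_mapE (F : {set {set T}}) (A : {set T}) S : F \subset pairs -> #|A| <= 2 ->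
  val S = [set A; ~: A] -> cube_map F S = if A \in F then A else ~: A.
Proof.
move=> FP A2 SE; have CA := cardsC A.
have CAF : ~: A \in F = false.
  by apply/negP => /(subsetP FP)/pairs_card; lia.
rewrite ffunE; case: pickP => [B|/(_ (if A \in F then A else ~: A))] /=.
  rewrite SE !inE /oriented => /andP[/orP[] /eqP->].
    by rewrite CAF /= andbT; case: ifP => // _; lia.
  by rewrite CAF setCK /=; case: ifP => // _; rewrite andbF.
rewrite SE /oriented; case: ifP => AF; first by rewrite set21 AF.
by rewrite set22 setCK AF CAF andbT /=; lia.
Qed.

Lemma cube_map_vertex (F : {set {set T}}) : F \subset pairs ->
  (forall A B, A \in F -> B \in F -> A :&: B != set0) ->
  is_buneman_vertex (cube_map F).
Proof.
move=> FP Fmeet; apply/andP; split; apply/forallP => S.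
  have [A [SE A12]] := small_part S sz.
  have A2 : #|A| <= 2 by case: A12 => [->|/pairs_card ->].
  by rewrite (cube_mapE FP A2 SE) SE; case: ifP; rewrite ?set21 ?set22.
apply/forallP => S'; apply/implyP => SS'.
have [A [SE A12]] := small_part S sz.
have A2 : #|A| <= 2 by case: A12 => [->|/pairs_card ->].
have [B [SE' B12]] := small_part S' sz.
have B2 : #|B| <= 2 by case: B12 => [->|/pairs_card ->].
have AB : A <> B by move=> AB; case/eqP: SS'; apply: val_inj; rewrite SE SE' AB.
rewrite (cube_mapE FP A2 SE) (cube_mapE FP B2 SE').
(* A pair contained in a set of at most two points equals that set. *)
have FC (C D : {set T}) : C \in F -> #|D| <= 2 -> C <> D -> C :&: ~: D != set0.
  move=> CF D2 CD; rewrite -setDE setD_eq0; apply/negP => sub; apply: CD; apply/eqP.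
  by rewrite eqEcard sub (pairs_card (subsetP FP _ CF)).
case: ifP => AF; case: ifP => BF.
- exact: Fmeet.
- exact: FC.
- by rewrite setIC FC // => BA; apply: AB.
(* Two small parts cover at most four of the five or more points, so their complements meet. *)
- rewrite -setCU -card_gt0; have := cardsC (A :|: B); have := cardsU A B; lia.
Qed.

Lemma hypercube_dim_ge (k : nat) :
  contains_hypercube (@buneman_adj _ SS) k -> k <= system_dim SS.
Proof.
move=> cube; rewrite /system_dim /hypercube_dim.
have k_lt : k < #|{: buneman SS}|.
  have /existsP[f /andP[/injectiveP inj _]] := cube.
  have := leq_card f inj; rewrite card_ffun card_bool card_ord.
  exact/leq_trans/ltn_expl.
by apply: (leq_bigmax_cond (Ordinal k_lt)).
Qed.

(** Edges at [a] all meet in [a], so every subset of them is a legitimate [F] for [cube_map]. Adding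
    or removing one edge flips one split, which gives a cube with one direction per edge. *)
Lemma degree_le_dim (a : T) : #|[set A in pairs | a \in A]| <= system_dim SS.
Proof.
apply: hypercube_dim_ge; set D := [set A in pairs | a \in A].
pose D_ (i : 'I_#|D|) : {set T} := enum_val i.
pose F (x : {ffun 'I_#|D| -> bool}) : {set {set T}} := 
  [set D_ i | i : 'I_#|D| & x i].
have FD x A : A \in F x -> A \in D by case/imsetP => i _ ->; apply: enum_valP.
have FP x : F x \subset pairs by apply/subsetP => A /FD; rewrite inE => /andP[].
have Fmeet x A B : A \in F x -> B \in F x -> A :&: B != set0.
  move=> /FD AD /FD BD; apply/set0Pn; exists a.
  by move: AD BD; rewrite !inE => /andP[_ ->] /andP[_ ->].
have FE x i : (D_ i \in F x) = x i.
  by rewrite mem_imset ?inE //; apply: enum_val_inj.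
pose f := [ffun x => (Sub _ (cube_map_vertex (FP x) (@Fmeet x)) : buneman SS)].
have fE x S : val (f x) S = cube_map (F x) S by rewrite ffunE.
have DP i : D_ i \in pairs.
  by have : D_ i \in D := enum_valP i; case/setIdP.
have sP i : {S : split_in SS | val S = [set D_ i; ~: D_ i]}.
  by have /setIdP[_ AS] := DP i; exists (Sub [set D_ i; ~: D_ i] AS).
pose s i := sval (sP i); have sE i : val (s i) = _ := svalP (sP i).
have A2 i : #|D_ i| = 2 := pairs_card (DP i).
(* Two edges with the same split are equal or complementary, and complementary pairs would leave
   only four points. *)
have s_inj : injective s.
  move=> i j ij; apply: enum_val_inj; apply/eqP.
  have : D_ i \in val (s j) by rewrite -ij sE set21.
  rewrite sE !inE => /orP[//|/eqP Aij].
  by have := cardsC (D_ j); rewrite -Aij !A2; lia.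
(* Both injectivity of [f] and adjacency along cube edges are read off from this set. *)
have diffE x y : [set S | val (f x) S != val (f y) S] =
    [set s i | i in [set i | x i != y i]].
  apply/setP => S; rewrite inE !fE; apply/idP/imsetP => [|[i]].
    have [A [SE A12]] := small_part S sz.
    have Ale2 : #|A| <= 2 by case: A12 => [->|/pairs_card ->].
    rewrite !(cube_mapE _ Ale2 SE) // => neq.
    have Fxy : (A \in F x) != (A \in F y).
      by apply: contraNneq neq => ->.
    have AD : A \in D.
      move: Fxy; case: (boolP (A \in F x)) => [/FD //|_].
      by case: (boolP (A \in F y)) => // /FD.
    have [i iA] : exists i, D_ i = A.
      by exists (enum_rank_in AD A); apply: enum_rankK_in.
    exists i; first by rewrite inE -!FE iA.
    by apply: val_inj; rewrite [RHS]sE iA SE.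
  rewrite inE => xyi ->; rewrite !(cube_mapE _ _ (sE i)) ?A2 // !FE.
  have ACA : D_ i != ~: D_ i.
    by apply/eqP => E; have := cardsC (D_ i); rewrite -E A2; lia.
  by move: xyi ACA; case: (x i); case: (y i) => // _; rewrite eq_sym.
apply/existsP; exists f; apply/andP; split.
  apply/injectiveP => x y xy; apply/ffunP => i; apply/eqP; apply: contraT => xyi.
  have : s i \in [set s i | i in [set i | x i != y i]] by rewrite imset_f ?inE.
  by rewrite -diffE xy inE eqxx.
apply/forallP => x; apply/forallP => y; apply/implyP => xy.
by rewrite /buneman_adj diffE card_imset.
Qed.

End Pairs.

(** * The lower bound, from the neighbourhoods of the ends of an edge *)

Lemma card2_eq (T : finType) (A : {set T}) x y :
  #|A| = 2 -> x \in A -> y \in A -> x != y -> A = [set x; y].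
Proof.
move=> A2 xA yA xy; apply/eqP; rewrite eq_sym eqEcard cards2 xy A2 andbT.
by apply/subsetP => z /set2P[] ->.
Qed.

Lemma pair_half_dim (T : finType) (SS : split_system T) :
  5 <= #|T| -> sizes_le2 SS -> injective_system SS -> #|T| %/ 2 <= system_dim SS.
Proof.
move=> T5 sz /(injective_pairsP sz) inj.
pose N a := [set c | [set a; c] \in pairs SS].
have NE a c : (c \in N a) = ([set a; c] \in pairs SS) by rewrite inE.
have degN a : #|N a| <= system_dim SS.
  apply: leq_trans (degree_le_dim sz T5 a).
  have Ninj : {in N a &, injective (fun c => [set a; c])}.
    move=> c d; rewrite inE => /pairs_card; rewrite cards2 => cN _ cd.
    have : c \in [set a; d] by rewrite -cd set22.
    by case/set2P => // ca; move: cN; rewrite ca eqxx.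
  rewrite -(card_in_imset Ninj); apply/subset_leq_card/subsetP => A /imsetP[c].
  by rewrite inE => ac ->; rewrite inE ac set21.
(* Without edges no two triples could be told apart, but there are at least ['C(5, 3)] of them. *)
have [A AP] : exists A, A \in pairs SS.
  apply/set0Pn; apply/eqP => P0.
  have /card_gt1P[Y [Y' [Y3 Y3' /eqP]]] :
      1 < #|[set Y : {set T} | #|Y| == 3]|.
    by rewrite card_draws (leq_trans _ (leq_bin2l 3 T5)).
  rewrite !inE in Y3 Y3'; case; apply: inj => [||A]; [exact/eqP|exact/eqP|].
  by rewrite P0 inE.
have /eqP/cards2P[a [b [ab AE]]] := pairs_card AP.
(* If [c] is adjacent to neither end, [ab] is the only edge in the triple [abc]. *)
have abN c : c \in ~: (N a :|: N b) -> forall B, B \in pairs SS ->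
    (B \subset [set a; b; c]) = (B == [set a; b]).
  move=> cN B BP; apply/idP/eqP => [/subsetP sub|->]; last first.
    by apply/subsetP => x xab; rewrite inE xab.
  have cB : c \notin B.
    apply/negP => cB; have /eqP/cards2P[x [y [xy BE]]] := pairs_card BP.
    have [z zc zB] : exists2 z, z != c & z \in B.
      have [xc|] := eqVneq x c; last by exists x; rewrite ?BE ?set21.
      by exists y; rewrite ?BE ?set22 // -xc eq_sym.
    have BE' := card2_eq (pairs_card BP) zB cB zc.
    have := sub _ zB; rewrite !inE (negPf zc) orbF => /orP[] /eqP zE;
      by move: cN; rewrite in_setC in_setU !NE -zE -BE' BP ?orbT.
  apply/eqP; rewrite eqEcard cards2 ab (pairs_card BP) andbT; apply/subsetP => x xB.
  have := sub _ xB; rewrite inE => /orP[//|/set1P xc].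
  by rewrite xc (negPf cB) in xB.
(* Two such points [c] and [d] would give different triples with the same single edge. *)
have compl1 : #|~: (N a :|: N b)| <= 1.
  rewrite leqNgt; apply/negP => /card_gt1P[c [d [cN dN cd]]].
  have ncab x : x \in ~: (N a :|: N b) -> x \notin [set a; b].
    move=> xN; apply/negP => /set2P[] xE; move: xN; rewrite in_setC in_setU !NE xE.
      by rewrite [[set b; a]]setUC -AE AP orbT.
    by rewrite -AE AP.
  have c3 x : x \in ~: (N a :|: N b) -> #|[set a; b; x]| = 3.
    by move=> /ncab xab; rewrite setUC cardsU1 cards2 ab xab.
  have E : [set a; b; c] = [set a; b; d].
    by apply: inj; rewrite ?c3 // => B BP; rewrite !abN.
  have : c \in [set a; b; d] by rewrite -E !inE eqxx orbT.
  by rewrite inE (negPf (ncab _ cN)) inE (negPf cd).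
(* The two degrees add up to at least [#|T| - 1]; rounding half of this up gives [#|T| %/ 2]. *)
have := cardsC (N a :|: N b); have := cardsU (N a) (N b).
have := degN a; have := degN b; lia.
Qed.

(** * From hypercubes to incompatible splits *)

Section Cubes.

Variables (T : finType) (SS : split_system T).
Implicit Types (u v w t : buneman SS).

Lemma buneman_adjP u v :
  reflect (exists S, forall S', (val u S' != val v S') = (S' == S)) (buneman_adj u v).
Proof.
apply: (iffP cards1P) => -[S SE]; exists S.
  by move=> S'; have /setP/(_ S') := SE; rewrite !inE.
by apply/setP => S'; rewrite !inE SE.
Qed.

(* In a 4-cycle [u v t w], opposite edges change the same split, so all four
   combinations of parts of the two splits occur among the vertices. *)
Lemma square_meet u v w t S S' :
  (forall S0, (val u S0 != val v S0) = (S0 == S)) ->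
  (forall S0, (val u S0 != val w S0) = (S0 == S')) ->
  buneman_adj v t -> buneman_adj w t -> v != w -> u != t ->
  S != S' /\ forall A B, A \in val S -> B \in val S' -> A :&: B != set0.
Proof.
move=> uv uw /buneman_adjP[S2 vt] /buneman_adjP[S4 wt] vw ut.
have eqn (x y : buneman SS) S0 : (val x S0 != val y S0) = false -> val x S0 = val y S0.
  by move/negbFE/eqP.
(* Changing the same split along both edges would lead to the same vertex. *)
have SS' : S != S'.
  apply: contraNneq vw => E; apply/eqP/val_inj/ffunP => S0.
  have [S0S|S0S] := eqVneq S0 S.
    have uv0 : val u S0 != val v S0 by rewrite uv S0S.
    have uw0 : val u S0 != val w S0 by rewrite uw S0S E.
    rewrite eq_sym in uv0.
    exact: part_neq2 (buneman_mem v S0) (buneman_mem u S0) (buneman_mem w S0) uv0 uw0.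
  rewrite -(eqn u v) ?uv ?(negPf S0S) //.
  by rewrite -(eqn u w) // uw -E (negPf S0S).
(* Otherwise [t] agrees with [u] on [S'], so the edge from [w] to [t] has to undo the change of
   [S'], and [t] is [u]. *)
have S2E : S2 = S'.
  apply/eqP; apply: contraT => S2S'.
  have S'S : S' == S = false by rewrite eq_sym (negPf SS').
  have tu : val u S' = val t S'.
    rewrite (eqn u v) ?uv //; apply: eqn.
    by rewrite vt eq_sym (negPf S2S').
  have S4E : S' = S4.
    by apply/eqP; rewrite -wt -tu eq_sym uw eqxx.
  case/eqP: ut; apply/val_inj/ffunP => S0.
  have [->//|S0S'] := eqVneq S0 S'.
  rewrite (eqn u w) ?uw ?(negPf S0S') //; apply: eqn.
  by rewrite wt -S4E (negPf S0S').
split=> // A B AS BS'.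
have part2 (x y : buneman SS) (S0 : split_in SS) (C : {set T}) :
    C \in val S0 -> val x S0 != val y S0 ->
    C = val x S0 \/ C = val y S0.
  move=> CS xy; have [->|Cx] := eqVneq C (val x S0); first by left.
  right; exact: part_neq2 CS (buneman_mem x S0) (buneman_mem y S0) Cx xy.
have uvS : val u S != val v S by rewrite uv.
have uwS : val u S' != val w S' by rewrite uw.
have uwE : val u S = val w S by apply: eqn; rewrite uw (negPf SS').
have uvE : val u S' = val v S' by apply: eqn; rewrite uv eq_sym (negPf SS').
have vtE : val v S = val t S by apply: eqn; rewrite vt S2E (negPf SS').
have vtS' : val v S' != val t S' by rewrite vt S2E.
have wtE : val w S' = val t S'.
  rewrite -uvE eq_sym in vtS'; symmetry.
  exact: part_neq2 (buneman_mem t S') (buneman_mem u S') (buneman_mem w S') vtS' uwS.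
case: (part2 _ _ _ _ AS uvS) => ->; case: (part2 _ _ _ _ BS' uwS) => ->.
- exact: buneman_meet.
- by rewrite uwE; apply: buneman_meet.
- by rewrite uvE; apply: buneman_meet.
- by rewrite vtE wtE; apply: buneman_meet.
Qed.

(** The [k] edges at one corner each change a split, and any two of them span a square, to which
    [square_meet] applies. *)
Lemma hypercube_splits (k : nat) : contains_hypercube (@buneman_adj _ SS) k ->
  exists S : 'I_k -> split_in SS, forall i j, i != j ->
    S i != S j /\ forall A B, A \in val (S i) -> B \in val (S j) -> A :&: B != set0.
Proof.
case/existsP => f /andP[/injectiveP f_inj /forallP f_adj].
pose flip (x : {ffun 'I_k -> bool}) i := [ffun j => (j == i) (+) x j].
have flipE (x : {ffun 'I_k -> bool}) i j : (x j != flip x i j) = (j == i).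
  by rewrite ffunE; case: (j == i); case: (x j).
have adj x i : buneman_adj (f x) (f (flip x i)).
  have /forallP/(_ (flip x i))/implyP := f_adj x; apply.
  by apply/cards1P; exists i; apply/setP => j; rewrite !inE flipE.
pose x0 : {ffun 'I_k -> bool} := [ffun=> false].
have [S SE] := fin_all_exists (fun i => buneman_adjP _ _ (adj x0 i)).
exists S => i j ij.
have flipC : flip (flip x0 i) j = flip (flip x0 j) i.
  by apply/ffunP => l; rewrite !ffunE addbCA.
apply: (square_meet (SE i) (SE j) (adj _ j)).
- by rewrite flipC; apply: adj.
- apply/eqP => /f_inj/ffunP/(_ i); rewrite !ffunE eqxx (negPf ij) //.
- apply/eqP => /f_inj/ffunP/(_ i); rewrite !ffunE eqxx (negPf ij) //.
Qed.

(** A singleton cannot meet both parts of another split. As [2 <= k], every direction has another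
    one to be compared with, so no direction changes a trivial split. *)
Lemma hypercube_pairs (k : nat) : sizes_le2 SS -> 2 <= k ->
  contains_hypercube (@buneman_adj _ SS) k ->
  exists F : {set {set T}}, [/\ F \subset pairs SS, #|F| = k &
    forall A B, A \in F -> B \in F -> A :&: B != set0].
Proof.
move=> sz k2 /hypercube_splits[S Smeet].
have other (i : 'I_k) : exists j, j != i.
  apply/existsP; apply: contraTT k2; rewrite negb_exists => /forallP all_i.
  rewrite -ltnNge ltnS -[k in k <= 1]card_ord -(cards1 i) -cardsT.
  by apply/subset_leq_card/subsetP => j _; rewrite inE; apply/negPn.
have small i : exists A : {set T}, A \in pairs SS /\ val (S i) = [set A; ~: A].
  have [A [SE [A1|AP]]] := small_part (S i) sz; last by exists A.
  have [j ji] := other i; have [_ ij] := Smeet _ _ ji.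
  have [B SBE] := split_inP (S j).
  have /cards1P[x AE] : #|A| == 1 by rewrite A1.
  have AS : A \in val (S i) by rewrite SE set21.
  have /set0Pn[y /setIP[yB]] := ij B A ltac:(by rewrite SBE set21) AS.
  have /set0Pn[z /setIP[zB]] := ij (~: B) A ltac:(by rewrite SBE set22) AS.
  by rewrite AE => /set1P zx /set1P yx; rewrite zx -yx inE yB in zB.
have [D DE] := fin_all_exists small.
have D_inj : injective D.
  move=> i j Dij; apply/eqP; apply: contraT => /Smeet[/eqP[]].
  by apply: val_inj; rewrite /= (proj2 (DE i)) (proj2 (DE j)) Dij.
exists [set D i | i : 'I_k]; split.
- by apply/subsetP => A /imsetP[i _ ->]; case: (DE i).
- by rewrite card_imset // card_ord.
move=> A B /imsetP[i _ ->] /imsetP[j _ ->].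
have [->|ij] := eqVneq i j.
  by rewrite setIid -card_gt0 (pairs_card (proj1 (DE j))).
have [_] := Smeet _ _ ij; apply; first by rewrite (proj2 (DE i)) set21.
by rewrite (proj2 (DE j)) set21.
Qed.

End Cubes.

(** * Intersecting families of edges, and split systems with prescribed edges *)

(** Two edges meet in some [a]. An edge that avoids [a] must join their other ends, which closes a
    triangle. *)
Lemma star_or_triangle (T : finType) (F : {set {set T}}) :
  (forall A, A \in F -> #|A| = 2) ->
  (forall A B, A \in F -> B \in F -> A :&: B != set0) -> 2 <= #|F| ->
  (exists a, forall A, A \in F -> a \in A) \/
  exists a b c, [/\ #|F| <= 3, [set a; b] \in F, [set a; c] \in F & [set b; c] \in F].
Proof.
move=> F2 Fmeet /card_gt1P[A [B [AF BF AB]]].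
have /set0Pn[a /setIP[aA aB]] := Fmeet _ _ AF BF.
have [/forall_inP star|] := boolP [forall A in F, a \in A]; first by left; exists a.
rewrite negb_forall_in => /exists_inP[C CF aC]; right.
have /set0Pn[b /setIP[bA bC]] := Fmeet _ _ AF CF.
have /set0Pn[c /setIP[cB cC]] := Fmeet _ _ BF CF.
have ab : a != b by apply: contraNneq aC => ->.
have ac : a != c by apply: contraNneq aC => ->.
have AE := card2_eq (F2 _ AF) aA bA ab; have BE := card2_eq (F2 _ BF) aB cB ac.
have bc : b != c by apply: contraNneq AB => bc; rewrite AE BE bc.
have CE := card2_eq (F2 _ CF) bC cC bc.
exists a, b, c; rewrite -AE -BE -CE; split=> //.
(* An edge meeting all three sides is a side: if it contains [a] it also meets [bc], and if not it
   contains both [b] and [c]. *)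
have sub : F \subset [set A; B; C].
  apply/subsetP => D DF; rewrite !inE.
  have := Fmeet _ _ DF AF; have := Fmeet _ _ DF BF; have := Fmeet _ _ DF CF.
  have D2 := F2 _ DF.
  have [aD|aD] := boolP (a \in D).
    move=> /set0Pn[x /setIP[xD]]; rewrite {1}CE => /set2P[] xE _ _.
      by rewrite AE (card2_eq D2 aD (y := b)) -?xE ?eqxx // xE.
    by rewrite BE (card2_eq D2 aD (y := c)) -?xE ?eqxx ?orbT // xE.
  move=> _ /set0Pn[x /setIP[xD]]; rewrite {1}BE => /set2P[] xE.
    by rewrite -xE xD in aD.
  move=> /set0Pn[y /setIP[yD]]; rewrite {1}AE => /set2P[] yE.
    by rewrite -yE yD in aD.
  by rewrite xE in xD; rewrite yE in yD; rewrite (card2_eq D2 yD xD bc) -CE eqxx !orbT.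
by rewrite (leq_trans (subset_leq_card sub)) // -setUA cardsU1 cards2; do 2!case: (~~ _).
Qed.

(** The trivial splits are added to those cut off by [E]. Complements of these small parts have at
    least three points, so no further pair arises. *)
Lemma pairs_realize (T : finType) (E : {set {set T}}) :
  5 <= #|T| -> (forall A, A \in E -> #|A| = 2) ->
  exists SS : split_system T, sizes_le2 SS /\ pairs SS = E.
Proof.
move=> T5 E2.
pose small := [set A : {set T} | (#|A| == 1) || (A \in E)].
pose CS := [set [set A; ~: A] | A in small].
have smallP A : A \in small -> #|A| = 1 \/ A \in E.
  by rewrite inE => /orP[/eqP|]; [left|right].
have small2 A : A \in small -> 0 < #|A| <= 2.
  by case/smallP => [->|/E2 ->].
have CS_split : is_split_system CS.
  apply/andP; split; last first.
    by apply/forallP => x; apply/imsetP; exists [set x]; rewrite ?inE ?cards1.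
  apply/forall_inP => _ /imsetP[A /small2 A2 ->].
  apply/existsP; exists A; rewrite eqxx andbT -!card_gt0.
  by have := cardsC A; lia.
pose SS : split_system T := Sub CS CS_split.
exists SS; split.
  apply/forall_inP => _ /imsetP[A AS ->]; rewrite split_sizeE.
  have := small2 _ AS; have := cardsC A.
  by case: (smallP _ AS) => [|/E2] ->; rewrite /minn; case: ifP; lia.
apply/setP => A; rewrite inE; apply/andP/idP => [[/eqP A2 /imsetP[B BS]]|AE].
  move=> /setP/(_ A); rewrite set21 => /esym/set2P[AB|AB].
    by rewrite AB in A2 *; case: (smallP _ BS) => //; rewrite A2.
  by have := small2 _ BS; have := cardsC B; rewrite -AB A2; lia.
split; first by rewrite E2.
by apply/imsetP; exists A => //; rewrite inE AE orbT.
Qed.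

(** * The complement of the [n]-cycle *)

Section CycleComplement.

Variable n : nat.

(** The rotation of the cycle, taken on [nat] so that its iterates reduce to arithmetic. *)
Definition cycle_succ (i : nat) : nat := if i.+1 == n then 0 else i.+1.

Definition near (i j : nat) : bool := [|| i == j, j == cycle_succ i | i == cycle_succ j].

Lemma nearC i j : near i j = near j i.
Proof. by rewrite /near eq_sym; congr orb; apply: orbC. Qed.

Lemma cycle_succ_inj i j : cycle_succ i = cycle_succ j -> i = j.
Proof. by rewrite /cycle_succ; do 2!case: eqP => //; [move=> <- [] | move=> _ _ []]. Qed.

Definition cycle_nonedges : {set {set 'I_n}} :=
  [set A : {set 'I_n} | (#|A| == 2) &&
     [forall x in A, forall y in A, (x != y) ==> ~~ near x y]].

Lemma cycle_nonedges2 (x y : 'I_n) : x != y ->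
  ([set x; y] \in cycle_nonedges) = ~~ near x y.
Proof.
move=> xy; rewrite inE cards2 xy /=; apply/idP/idP.
  by move/forall_inP/(_ x (set21 _ _))/forall_inP/(_ y (set22 _ _))/implyP/(_ xy).
move=> nxy; apply/forall_inP => a aA; apply/forall_inP => b bA; apply/implyP.
by case/set2P: aA => ->; case/set2P: bA => ->; rewrite ?eqxx // nearC.
Qed.

Hypothesis n5 : 5 <= n.

Lemma cycle_succ_lt i : i < n -> cycle_succ i < n.
Proof. by rewrite /cycle_succ; case: eqP; lia. Qed.

(** The iterate is addition of [k] modulo [n]. The cases [k <= 4] exclude short cycles, which is
    where [5 <= n] enters. *)
Lemma cycle_succ_acyclic k i : 0 < k < n -> i < n -> iter k cycle_succ i != i.
Proof.
move=> kn i_lt.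
suff -> : iter k cycle_succ i = if i + k < n then i + k else i + k - n.
  by case: ifP; lia.
case/andP: kn => _; elim: k => [|k IH] k_lt; first by rewrite addn0 i_lt.
rewrite iterS (IH (ltnW k_lt)) /cycle_succ addnS.
by have [?|?] := ltnP (i + k) n; repeat case: ifP => ?; lia.
Qed.

Lemma near_neighbours x y z : near x y -> near x z -> y != x -> z != x -> y != z ->
  y = cycle_succ x /\ x = cycle_succ z \/ z = cycle_succ x /\ x = cycle_succ y.
Proof.
rewrite /near ![x == _]eq_sym => + + yx zx yz; rewrite (negPf yx) (negPf zx) /=.
case/orP=> /eqP xy; case/orP=> /eqP xz.
- by rewrite xy xz eqxx in yz.
- by left.
- by right.
- by case/eqP: yz; apply: cycle_succ_inj; rewrite xy xz.
Qed.

(** Otherwise the three points would form a triangle in the cycle. *)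
Lemma near_path x y z : x < n -> near x y -> near x z ->
  y != x -> z != x -> y != z -> ~~ near y z.
Proof.
move=> x_lt xy xz yx zx yz.
wlog [yE xE] : y z xy xz yx zx yz / y = cycle_succ x /\ x = cycle_succ z.
  move=> H; case: (near_neighbours xy xz yx zx yz) => E; first exact: H.
  by rewrite nearC H // eq_sym.
rewrite /near (negPf yz) /=; apply/norP; split; apply/eqP => zE.
  have /eqP[] : iter 3 cycle_succ x != x by apply: cycle_succ_acyclic; lia.
  by rewrite /= -yE -zE.
by case/eqP: yx; rewrite zE -xE.
Qed.

(** Either [x] and [w] have the same successor, or four successor steps lead from [x] back to
    itself. *)
Lemma near_square x y z w : x < n -> near x y -> near x z -> near w y -> near w z ->
  y != x -> z != x -> y != z -> y != w -> z != w -> w = x.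
Proof.
move=> x_lt xy xz wy wz yx zx yz yw zw.
have n4 : iter 4 cycle_succ x <> x by apply/eqP/cycle_succ_acyclic; lia.
case: (near_neighbours xy xz yx zx yz) => -[E1 E2];
  case: (near_neighbours wy wz yw zw yz) => -[E3 E4].
- by apply: cycle_succ_inj; rewrite -E1 -E3.
- by case: n4; rewrite /= -E1 -E4 -E3.
- by case: n4; rewrite /= -E1 -E4 -E3.
- by apply: cycle_succ_inj; rewrite -E1 -E3.
Qed.

(** In the 5-cycle the two points not near [a] are adjacent; all cases are enumerated. *)
Lemma near_triangle a b c : a < n -> b < n -> c < n -> n <= 5 ->
  ~~ near a b -> ~~ near a c -> near b c.
Proof.
move=> + + + n_le; have nE : n = 5 by apply/eqP; rewrite eqn_leq n_le n5.
rewrite /near /cycle_succ nE.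
by case: a => [|[|[|[|[|a]]]]] // _; case: b => [|[|[|[|[|b]]]]] // _;
  case: c => [|[|[|[|[|c]]]]].
Qed.

(* The points of [Y] other than [x] are its two cycle neighbours, hence form a
   pair; the same pair belongs to [Y'], whose third point would then close a
   4-cycle with [x]. *)
Lemma cycle_nonedges_inj (Y Y' : {set 'I_n}) : #|Y| = 3 -> #|Y'| = 3 ->
  (forall A, A \in cycle_nonedges -> (A \subset Y) = (A \subset Y')) -> Y = Y'.
Proof.
move=> Y3 Y3' same; apply/eqP; apply: contraT => YY'.
have pairE (x y : 'I_n) : x != y -> ~~ near x y ->
    (x \in Y) && (y \in Y) = (x \in Y') && (y \in Y').
  move=> xy nxy; have := same [set x; y]; rewrite cycle_nonedges2 // => /(_ nxy).
  by rewrite !subUset !sub1set.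
have diff (Z Z' : {set 'I_n}) : #|Z| = 3 -> #|Z'| = 3 -> Z != Z' ->
    exists2 x, x \in Z & x \notin Z'.
  move=> Z3 Z3' ZZ'; apply/subsetPn; apply: contra ZZ' => sub.
  by rewrite eqEcard sub Z3 Z3'.
have [x xY xY'] := diff _ _ Y3 Y3' YY'.
have [w wY' wY] : exists2 w, w \in Y' & w \notin Y by apply: diff; rewrite // eq_sym.
have /eqP/cards2P[y [z [yz Yx]]] : #|Y :\ x| = 2.
  by have := cardsD1 x Y; rewrite xY Y3 => -[].
have /setD1P[yx yY] : y \in Y :\ x by rewrite Yx set21.
have /setD1P[zx zY] : z \in Y :\ x by rewrite Yx set22.
(* A nonadjacent [t] would form with [x] a pair lying in [Y] but not in [Y']. *)
have nearx t : t \in Y -> t != x -> near x t.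
  move=> tY tx; apply: contraT => ntx; rewrite eq_sym in tx.
  by have := pairE _ _ tx ntx; rewrite xY tY (negPf xY').
have nearw t : t \in Y' -> t != w -> near w t.
  move=> tY tw; apply: contraT => ntw; rewrite eq_sym in tw.
  by have := pairE _ _ tw ntw; rewrite wY' tY (negPf wY).
have xy := nearx _ yY yx; have xz := nearx _ zY zx.
have nyz : ~~ near y z by apply: (near_path (x := x)).
have [yY' zY'] : y \in Y' /\ z \in Y'.
  by apply/andP; rewrite -(pairE y z) ?yY ?zY.
have yw : y != w by apply: contraNneq wY => <-.
have zw : z != w by apply: contraNneq wY => <-.
have wy := nearw _ yY' yw; have wz := nearw _ zY' zw.
have wx : w = x by apply: val_inj; apply: (near_square (x := x) (w := w) (y := y) (z := z)).
by rewrite wx xY in wY.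
Qed.

(** The point [a], its predecessor and its successor are three distinct points near [a], leaving
    [n - 3] possible other ends. *)
Lemma cycle_nonedges_star (a : 'I_n) (F : {set {set 'I_n}}) :
  F \subset cycle_nonedges -> (forall A, A \in F -> a \in A) -> #|F| <= n - 3.
Proof.
move=> FE Fa; pose N := [set b : 'I_n | ~~ near a b].
have sub : F \subset [set [set a; b] | b in N].
  apply/subsetP => A AF; have AE := subsetP FE _ AF.
  have A2 : #|A| = 2 by move: AE; rewrite inE => /andP[/eqP].
  have aA := Fa _ AF; have /eqP/cards1P[b Ab] : #|A :\ a| = 1.
    by have := cardsD1 a A; rewrite aA A2 => -[].
  have /setD1P[ba bA] : b \in A :\ a by rewrite Ab set11.
  have ab : a != b by rewrite eq_sym.
  have Aab := card2_eq A2 aA bA ab.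
  by apply/imsetP; exists b => //; rewrite inE -cycle_nonedges2 // -Aab.
apply: leq_trans (subset_leq_card sub) _; apply: leq_trans (leq_imset_card _ _) _.
pose s := Ordinal (cycle_succ_lt (ltn_ord a)).
have [p pE] : exists p : 'I_n, a = cycle_succ p :> nat.
  (* The predecessor of [0] wraps around to [n.-1]. *)
  have [a0|a_gt0] := posnP a.
    have p_lt : n.-1 < n by lia.
    by exists (Ordinal p_lt); rewrite a0 /cycle_succ /= prednK ?eqxx //; lia.
  have p_lt : a.-1 < n by apply: leq_ltn_trans (leq_pred a) (ltn_ord a).
  by exists (Ordinal p_lt); rewrite /cycle_succ /= prednK // ltn_eqF.
have sub3 : [set a; p; s] \subset ~: N.
  apply/subsetP => t; rewrite !inE negbK => /orP[/orP[]|] /eqP->; rewrite /near.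
  - by rewrite eqxx.
  - by rewrite pE eqxx !orbT.
  - by rewrite eqxx orbT.
have card3 : #|[set a; p; s]| = 3.
  have ap : (a == p :> nat) = false.
    by rewrite pE; apply: negPf; apply: (@cycle_succ_acyclic 1 p) => //; lia.
  have as_ : (a == cycle_succ a :> nat) = false.
    by rewrite eq_sym; apply: negPf; apply: (@cycle_succ_acyclic 1 a) => //; lia.
  have ps : (p == cycle_succ a :> nat) = false.
    by rewrite pE eq_sym; apply: negPf; apply: (@cycle_succ_acyclic 2 p) => //; lia.
  by rewrite -setUA cardsU1 cards2 !inE -!val_eqE /= ap as_ ps.
have := subset_leq_card sub3; rewrite card3.
by have := cardsC N; rewrite card_ord; move: #|_| #|_|; lia.
Qed.

(** A triangle has three edges, which exceeds [n - 3] only for [n = 5], and there [near_triangle]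
    rules it out. *)
Lemma cycle_nonedges_clique (F : {set {set 'I_n}}) : F \subset cycle_nonedges ->
  (forall A B, A \in F -> B \in F -> A :&: B != set0) -> 2 <= #|F| -> #|F| <= n - 3.
Proof.
move=> FE Fmeet F2.
have Fcard A : A \in F -> #|A| = 2.
  by move/(subsetP FE); rewrite inE => /andP[/eqP].
have [[a Fa]|[a [b [c [F3 ab ac bc]]]]] := star_or_triangle Fcard Fmeet F2.
  exact: cycle_nonedges_star Fa.
have nonnear (x y : 'I_n) : [set x; y] \in F -> ~~ near x y.
  move=> xyF; rewrite -cycle_nonedges2 ?(subsetP FE) //.
  by have := Fcard _ xyF; rewrite cards2; case: (x != y).
rewrite leqNgt; apply: contra (nonnear _ _ bc) => nF.
apply: (near_triangle (a := a)) (nonnear _ _ ab) (nonnear _ _ ac) => //.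
by move: (#|F|) F3 nF; lia.
Qed.

End CycleComplement.

(** * Both bounds for the minimum *)

Lemma S2P (n : nat) (SS : split_system 'I_n) :
  (SS \in S2 n) = injective_system SS && sizes_le2 SS.
Proof. by rewrite inE. Qed.

Lemma S2_upper (n : nat) : 5 <= n ->
  exists2 SS : split_system 'I_n, SS \in S2 n & system_dim SS <= n - 3.
Proof.
move=> n5; have nonedges_card A : A \in cycle_nonedges n -> #|A| = 2.
  by rewrite inE => /andP[/eqP].
have [|SS [sz SSE]] := @pairs_realize 'I_n _ _ nonedges_card; first by rewrite card_ord.
exists SS.
  rewrite S2P sz andbT; apply/(injective_pairsP sz); rewrite SSE => Y Y'.
  exact: cycle_nonedges_inj.
rewrite /system_dim /hypercube_dim; apply/bigmax_leqP => k.
(* Cubes of dimension at most 1 are covered by [1 <= n - 3]. *)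
have [k2 /(hypercube_pairs sz k2)[F [FE Fk Fmeet]]|k1 _] := leqP 2 k; last first.
  by rewrite ltnS in k1; apply: leq_trans k1 _; rewrite ltn_subRL; apply: leq_trans n5.
by rewrite -Fk; apply: cycle_nonedges_clique; rewrite // -?SSE // Fk.
Qed.

Theorem theorem4 (n : nat) (hn : 5 <= n) : n %/ 2 <= ID2 n <= n - 3.
Proof.
have [SS1 SS1_S2 SS1_dim] := S2_upper hn.
(* The witness for the upper bound excludes the default value [0]. *)
rewrite /ID2; case: pickP => [SS0 SS0_S2|none]; last by rewrite none in SS1_S2.
case: arg_minnP => // SS SS_S2 SS_min; apply/andP; split.
  move: SS_S2; rewrite S2P => /andP[inj sz].
  by rewrite -{1}(card_ord n); apply: pair_half_dim; rewrite ?card_ord.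
exact: leq_trans (SS_min _ SS1_S2) SS1_dim.
Qed.
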